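(* For AM-stationary feasible points $\bar x$ of orthodisjunctive problems (ODP), ODP-subMFC at $\bar x$ is independent of AM-regularity at $\bar x$ and independent of AS-regularity at $\bar x$. That is, none of the following four implications is valid for all problems (ODP) and all AM-stationary points $\bar x$: ODP-subMFC at $\bar x$ $\Rightarrow$ AM-regularity at $\bar x$; AM-regularity at $\bar x$ $\Rightarrow$ ODP-subMFC at $\bar x$; ODP-subMFC at $\bar x$ $\Rightarrow$ AS-regularity at $\bar x$; AS-regularity at $\bar x$ $\Rightarrow$ ODP-subMFC at $\bar x$.
   Context: (ODP): $\min_x f(x)$ s.t. $F(x)\in\Gamma=\bigcup_{j=1}^t\Gamma_j$, where $f\colon\mathbb{R}^n\to\mathbb{R}$, $F\colon\mathbb{R}^n\to\mathbb{R}^\ell$ are continuously differentiable and $\Gamma_j=\prod_{i=1}^\ell[a_i^j,b_i^j]$ with $-\infty\le a_i^j\le b_i^j\le\infty$; here $[-\infty,r]=(-\infty,r]$, $[r,\infty]=[r,\infty)$ for $r\in\mathbb{R}$, and $[-\infty,\infty]=\mathbb{R}$. $[\ell]=\{1,\dots,\ell\}$; $\operatorname{sgn}\colon\mathbb{R}\to\{-1,0,1\}$ is the sign function. For a closed set $\Omega$ and $y\in\Omega$, the regular normal cone is $\widehat N_\Omega(y)=\{\xi\mid \forall z\in\Omega\colon \xi^\top(z-y)\le o(\|z-y\|)\}$; the limiting normal cone $N_\Omega(y)$ is the set of all limits of sequences $\xi^k\in\widehat N_\Omega(y^k)$ with $y^k\to y$, $y^k\in\Omega$. Both are $\emptyset$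 for $y\notin\Omega$. For a set-valued map $\Upsilon$, $\limsup_{z\to\bar z}\Upsilon(z)$ is the set of all $y$ for which there exist $z^k\to\bar z$ and $y^k\to y$ with $y^k\in\Upsilon(z^k)$ for all $k$. A feasible point $\bar x$ is AM-regular if $\limsup_{x\to\bar x,\,\delta\to0}F'(x)^\top N_\Gamma(F(x)-\delta)\subset F'(\bar x)^\top N_\Gamma(F(\bar x))$, and AS-regular if $\limsup_{x\to\bar x}F'(x)^\top\widehat N_\Gamma(F(\bar x))\subset F'(\bar x)^\top\widehat N_\Gamma(F(\bar x))$. For $(x,\delta)$ with $F(x)-\delta\in\Gamma$: $J(x,\delta)=\{j\in[t]\mid F(x)-\delta\in\Gamma_j\}$, $I^\exists(x,\delta)=\{i\in[\ell]\mid\exists j\in J(x,\delta)\colon F_i(x)-\delta_i\in\{a_i^j,b_i^j\}\}$, and $I^\exists(\bar x)=I^\exists(\bar x,0)$. A sequence $\{(x^k,\lambda^k,\delta^k,\varepsilon^k)\}_{k=1}^\infty\subset\mathbb{R}^n\times\mathbb{R}^\ell\times\mathbb{R}^\ell\times\mathbb{R}^n$ is approximately M-stationary w.r.t. the feasible point $\bar x$ if $(x^k,\delta^k,\varepsilon^k)\to(\bar x,0,0)$ and, for all $k$, $\varepsilon^k=\nabla f(x^k)+F'(x^k)^\top\lambda^k$ and $\lambda^k\in N_\Gamma(F(x^k)-\delta^k)$. $\bar x$ is AM-stationary if such a sequence exists. Convention: passing to subsequences, all such sequences considered are taken such that $J(x^k,\delta^k)$, $I^\exists(x^k,\delta^k)$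 and the signs $\operatorname{sgn}(\lambda_i^k)$, $i\in[\ell]$, do not depend on $k$. ODP-subMFC holds at an AM-stationary point $\bar x$ if there exist $I\subset I^\exists(\bar x)$ and a sequence $\{(x^k,\lambda^k,\delta^k,\varepsilon^k)\}_{k=1}^\infty$ such that: (i) either $I=\emptyset$, or for all $u\in\mathbb{R}^\ell\setminus\{0\}$ with $u\ge0$ and $u_{[\ell]\setminus I}=0$, $0\neq\sum_{i\in I}\operatorname{sgn}(\lambda_i^k)u_i\nabla F_i(\bar x)$; (ii) the sequence is approximately M-stationary w.r.t. $\bar x$, and $I=I^\exists(x^k,\delta^k)$ for all $k\in\mathbb{N}$. *)

(* Defs.v *)
From HB Require Import structures.
From mathcomp Require Import all_boot all_order all_algebra.
From mathcomp Require Import all_classical all_reals all_analysis.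
Set Implicit Arguments.
Unset Strict Implicit.
Unset Printing Implicit Defensive.
Import Order.TTheory GRing.Theory Num.Theory numFieldNormedType.Exports.
Local Open Scope classical_set_scope.
Local Open Scope ring_scope.

(* Points of R^n are row vectors 'rV[R]_n. The norm on them is the library's
   max norm; the notions below (limits, little-o) depend only on its
   equivalence class. *)

Definition grad (R : realType) (n : nat) (g : 'rV[R]_n -> R) (x : 'rV[R]_n) :
    'rV[R]_n :=
  \row_(j < n) 'D_(delta_mx 0 j) g x.

(* The sets are read as subsets of R^l, so infinite bounds are never attained:
   [-oo, r] is ]-oo, r], [r, +oo] is [r, +oo[ and [-oo, +oo] is R. *)
Record odp (R : realType) (n l t : nat) := Odp {
  obj : 'rV[R]_n -> R;
  con : 'rV[R]_n -> 'rV[R]_l;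
  lbd : 'I_t -> 'I_l -> \bar R;
  ubd : 'I_t -> 'I_l -> \bar R;
  obj_differentiable : forall x, differentiable obj x;
  obj_C1 : continuous (grad obj);
  con_differentiable : forall x, differentiable con x;
  con_C1 : continuous (fun x => 'J con x);
  lbd_le_ubd : forall j i, (lbd j i <= ubd j i)%E
}.

Section NormalCones.
Variables (R : realType) (l : nat).
Implicit Types (Omega : set 'rV[R]_l) (y xi : 'rV[R]_l).

Definition dotprod (u v : 'rV[R]_l) : R := \sum_(i < l) u 0 i * v 0 i.

Definition regular_normal_cone Omega y : set 'rV[R]_l :=
  [set xi | Omega y /\
    forall e : R, 0 < e ->
      \forall z \near y, Omega z -> dotprod xi (z - y) <= e * `|z - y|].

Definition limiting_normal_cone Omega y : set 'rV[R]_l :=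
  [set xi | Omega y /\
    exists (ys xis : nat -> 'rV[R]_l),
      [/\ ys @ \oo --> y, xis @ \oo --> xi &
          forall k, Omega (ys k) /\ regular_normal_cone Omega (ys k) (xis k)]].

End NormalCones.

Definition outer_limit (X Y : topologicalType) (U : X -> set Y) (zbar : X) :
    set Y :=
  [set y | exists (z : nat -> X) (ys : nat -> Y),
    [/\ z @ \oo --> zbar, ys @ \oo --> y & forall k, U (z k) (ys k)]].

Section OrthodisjunctiveProblem.
Variables (R : realType) (n l t : nat) (P : odp R n l t).
Implicit Types (x xbar : 'rV[R]_n) (y delta lam : 'rV[R]_l) (I : {set 'I_l}).

Definition in_box (j : 'I_t) y : bool :=
  [forall i : 'I_l, (lbd P j i <= (y 0 i)%:E <= ubd P j i)%E].

Definition Gamma : set 'rV[R]_l := \bigcup_(j : 'I_t) [set y | in_box j y].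

Definition feasible x : Prop := Gamma (con P x).

(* The library's Jacobian acts on row vectors on the right, i.e. it is the
   transpose of the derivative F'(x); hence this is F'(x)^T lam as a row. *)
Definition derT x lam : 'rV[R]_n := lam *m ('J (con P) x)^T.

Definition AM_regular xbar : Prop :=
  outer_limit
    (fun p : 'rV[R]_n * 'rV[R]_l =>
       derT p.1 @` limiting_normal_cone Gamma (con P p.1 - p.2))
    (xbar, 0)
  `<=` derT xbar @` limiting_normal_cone Gamma (con P xbar).

Definition AS_regular xbar : Prop :=
  outer_limit
    (fun x => derT x @` regular_normal_cone Gamma (con P xbar)) xbar
  `<=` derT xbar @` regular_normal_cone Gamma (con P xbar).

Definition Jact x delta : {set 'I_t} :=
  [set j | in_box j (con P x - delta)]%SET.

Definition Iex x delta : {set 'I_l} :=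
  [set i | [exists j in Jact x delta,
     (((con P x - delta) 0 i)%:E == lbd P j i) ||
     (((con P x - delta) 0 i)%:E == ubd P j i)]]%SET.

(* The conditions on Jact, Iex and the signs encode the convention that, after
   passing to subsequences, these do not depend on k. *)
Definition approx_M_stationary xbar (xs : nat -> 'rV[R]_n)
    (lams deltas : nat -> 'rV[R]_l) (epss : nat -> 'rV[R]_n) : Prop :=
  [/\ [/\ xs @ \oo --> xbar, deltas @ \oo --> (0 : 'rV[R]_l) &
          epss @ \oo --> (0 : 'rV[R]_n)],
      forall k, epss k = grad (obj P) (xs k) + derT (xs k) (lams k),
      forall k, limiting_normal_cone Gamma (con P (xs k) - deltas k) (lams k) &
      forall k m,
        [/\ Jact (xs k) (deltas k) = Jact (xs m) (deltas m),
            Iex (xs k) (deltas k) = Iex (xs m) (deltas m) &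
            forall i, Num.sg (lams k 0 i) = Num.sg (lams m 0 i)]].

Definition AM_stationary xbar : Prop :=
  feasible xbar /\
  exists xs lams deltas epss, approx_M_stationary xbar xs lams deltas epss.

Definition odp_subMFC xbar : Prop :=
  exists (I : {set 'I_l}) (xs : nat -> 'rV[R]_n) (lams deltas : nat -> 'rV[R]_l)
         (epss : nat -> 'rV[R]_n),
    [/\ I \subset Iex xbar 0,
        I = finset.set0 \/
        (forall (k : nat) (u : 'rV[R]_l), u != 0 ->
           (forall i, 0 <= u 0 i) -> (forall i, i \notin I -> u 0 i = 0) ->
           0 != \sum_(i in I) (Num.sg (lams k 0 i) * u 0 i) *:
                  grad (fun x => con P x 0 i) xbar),
        approx_M_stationary xbar xs lams deltas epss &
        forall k, I = Iex (xs k) (deltas k)].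

End OrthodisjunctiveProblem.

(* Main.v *)
Require Import Defs.
From HB Require Import structures.
From mathcomp Require Import all_boot all_order all_algebra.
From mathcomp Require Import all_classical all_reals all_analysis.

(** Two one-dimensional problems with a constant objective refute the four
    implications, each problem serving for both regularity conditions.

    Minimize 0 subject to x^2 <= 0, at the only feasible point 0.  Shifting
    the constraint by positive delta_k -> 0 puts F(0) - delta_k = - delta_k in
    the interior of Gamma, so that no constraint is active along the sequence,
    and ODP-subMFC holds with I empty ([square_subMFC]).  On the other hand
    F'(x) = 2 x vanishes at 0 but not nearby, and the normal cone to the
    half-line at 0 is unbounded: the multipliers 1 / (2 x_k) give
    F'(x_k) lambda_k = 1 for x_k -> 0, whereas F'(0) only produces 0.  Hence
    neither regularity condition holds ([square_not_AM_regular],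
    [square_not_AS_regular]).

    Minimize 0 subject to F(x) = 0 with F identically 0.  As F' = 0, both
    regularity conditions reduce to the inclusion of {0} in {0}
    ([null_AM_regular], [null_AS_regular]).  An equality constraint is active
    at each shifted point, which forces I to be the whole index set, and a
    vanishing gradient is not positively linearly independent
    ([null_not_subMFC]). *)

Set Implicit Arguments.
Unset Strict Implicit.
Unset Printing Implicit Defensive.
Import Order.TTheory GRing.Theory Num.Theory numFieldNormedType.Exports.
Local Open Scope classical_set_scope.
Local Open Scope ring_scope.

(** * Normal cones and constant maps *)

Section Cones.
Context {R : realType} {l : nat}.
Implicit Types (Omega : set 'rV[R]_l) (y xi : 'rV[R]_l).

Lemma regular_normal_cone0 Omega y : Omega y -> regular_normal_cone Omega y 0.
Proof.
move=> Oy; split=> // e e0; near=> z => _.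
rewrite /dotprod big1 => [|i _]; first by rewrite mulr_ge0 ?normr_ge0 ?ltW.
by rewrite mxE mul0r.
Unshelve. all: by end_near. Qed.

Lemma regular_normal_cone_limiting Omega y :
  regular_normal_cone Omega y `<=` limiting_normal_cone Omega y.
Proof.
move=> xi Nxi; have Oy := Nxi.1; split=> //.
by exists (fun=> y), (fun=> xi); split=> //; exact: cvg_cst.
Qed.

Lemma limiting_normal_cone0 Omega y : Omega y -> limiting_normal_cone Omega y 0.
Proof.
by move=> Oy; apply/regular_normal_cone_limiting/regular_normal_cone0.
Qed.

End Cones.

Section Problems.
Context {R : realType}.

Lemma grad_cst n (c : R) (x : 'rV[R]_n) : grad (cst c) x = 0.
Proof. by apply/rowP => j; rewrite !mxE derive_cst. Qed.

Lemma continuous_grad_cst n (c : R) : continuous (grad (@cst 'rV[R]_n R c)).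
Proof.
move=> x; rewrite (_ : grad _ = cst 0); first exact: cst_continuous.
by apply/funext => z; exact: grad_cst.
Qed.

Lemma jacobian_cst n l (c : 'rV[R]_l) (x : 'rV[R]_n) : 'J (cst c) x = 0.
Proof. by apply/matrixP => i j; rewrite !mxE diff_cst !mxE. Qed.

Lemma continuous_jacobian_cst n l (c : 'rV[R]_l) :
  continuous (fun x : 'rV[R]_n => 'J (cst c) x).
Proof.
move=> x; rewrite (_ : (fun _ => _) = cst 0); first exact: cst_continuous.
by apply/funext => z; exact: jacobian_cst.
Qed.

Lemma subMFC_AM_stationary n l t (P : odp R n l t) (xbar : 'rV[R]_n) :
  feasible P xbar -> odp_subMFC P xbar -> AM_stationary P xbar.
Proof.
move=> fP [I [xs [lams [deltas [epss [_ _ apx _]]]]]].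
by split=> //; exists xs, lams, deltas, epss.
Qed.

(** * The constraint x^2 <= 0 *)

Definition sqmap (x : 'rV[R]_1) : 'rV[R]_1 := const_mx (x 0 0 ^+ 2).

Lemma is_diff_sqmap (x : 'rV[R]_1) :
  is_diff x sqmap (fun v => const_mx (2 * x 0 0 * v 0 0)).
Proof.
have dc : is_diff x (fun N : 'rV[R]_1 => N 0 0) (fun N => N 0 0).
  apply: DiffDef; first exact: differentiable_coord.
  have lin : linear (fun N : 'rV[R]_1 => N 0 0 : R) by move=> a u v; rewrite !mxE.
  pose f := HB.pack_for {linear 'rV[R]_1 -> R} (fun N : 'rV[R]_1 => N 0 0 : R)
    (GRing.isLinear.Build _ _ _ _ _ lin).
  by apply: (diff_lin (f := f)); exact: coord_continuous.
rewrite (_ : sqmap =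
    ( *:%R ^~ (const_mx 1)) \o ((fun N : 'rV[R]_1 => N 0 0) ^+ 2)); last first.
  by apply/funext => z; apply/rowP => j; rewrite !mxE mulr1 exprfctE.
apply: is_diff_eq; apply/funext => v; apply/rowP => j.
by rewrite !mxE /= mulr1 expr1.
Qed.

Lemma differentiable_sqmap (x : 'rV[R]_1) : differentiable sqmap x.
Proof. by have [] := is_diff_sqmap x. Qed.

Lemma jacobian_sqmap (x : 'rV[R]_1) : 'J sqmap x = const_mx (2 * x 0 0).
Proof.
apply/matrixP => i j.
by rewrite !mxE (@diff_val _ _ _ _ _ _ _ (is_diff_sqmap x)) !ord1 !mxE eqxx mulr1.
Qed.

Lemma continuous_jacobian_sqmap : continuous (fun x => 'J sqmap x).
Proof.
move=> x; rewrite (_ : (fun _ => _) =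
    fun x : 'rV[R]_1 => (2 * x 0 0) *: const_mx 1 :> 'M[R]_1); last first.
  apply/funext => z; rewrite jacobian_sqmap.
  by apply/matrixP => i j; rewrite !mxE mulr1.
apply: (@continuousZr_tmp R 'M[R]_1 _ (fun z : 'rV[R]_1 => 2 * z 0 0 : R)).
by apply: continuousM; [exact: cst_continuous | exact: coord_continuous].
Qed.

Definition square_odp : odp R 1 1 1 :=
  @Odp R 1 1 1 (cst 0) sqmap (fun _ _ => -oo%E) (fun _ _ => 0%E)
    (fun x => differentiable_cst 0 x) (@continuous_grad_cst 1 0)
    differentiable_sqmap
    continuous_jacobian_sqmap (fun _ _ => leNye 0%E).

Lemma square_in_box j (y : 'rV[R]_1) : in_box square_odp j y = (y 0 0 <= 0).
Proof.
apply/forallP/idP => [/(_ 0)/=|y0 i]; first by rewrite leNye lee_fin.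
by rewrite (ord1 i) /= leNye lee_fin.
Qed.

Lemma square_GammaE (y : 'rV[R]_1) : Gamma square_odp y <-> y 0 0 <= 0.
Proof.
split=> [[j _] /=|y0]; first by rewrite square_in_box.
by exists 0 => //=; rewrite square_in_box.
Qed.

Lemma square_derT x (lam : 'rV[R]_1) :
  derT square_odp x lam = const_mx (lam 0 0 * (2 * x 0 0)).
Proof.
by apply/rowP => j; rewrite /derT /= jacobian_sqmap !mxE big_ord1 !mxE.
Qed.

Lemma sqmap0 : sqmap 0 = 0.
Proof. by apply/rowP => j; rewrite !mxE expr0n. Qed.

Lemma square_regular_normal_cone (c : R) : 0 <= c ->
  regular_normal_cone (Gamma square_odp) 0 (const_mx c).
Proof.
move=> c0; split=> [|e e0]; first by apply/square_GammaE; rewrite mxE.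
near=> z => /square_GammaE z0; rewrite /dotprod big_ord1 !mxE subr0.
by rewrite (@le_trans _ _ 0) ?mulr_ge0_le0// mulr_ge0// ltW.
Unshelve. all: by end_near. Qed.

Lemma cvg_const_harmonic : (fun k => const_mx (harmonic k) : 'rV[R]_1) @ \oo --> (0 : 'rV[R]_1).
Proof.
rewrite (_ : (fun _ => _) = fun k => harmonic k *: const_mx 1); last first.
  by apply/funext => k; apply/rowP => j; rewrite !mxE mulr1.
rewrite -(scale0r (const_mx 1)).
by apply: cvgZr_tmp; exact: cvg_harmonic.
Qed.

(** The shifts must be positive for the constraint to be inactive, which leaves
    the multiplier 0 as the only normal vector. *)
Lemma square_subMFC : odp_subMFC square_odp 0.
Proof.
have dk k : square_odp.(con) 0 - const_mx (harmonic k) = const_mx (- harmonic k).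
  by apply/rowP => j; rewrite /= sqmap0 !mxE sub0r.
have J0 k : Jact square_odp 0 (const_mx (harmonic k)) = finset.setT.
  apply/setP => j; rewrite !inE square_in_box dk mxE oppr_le0.
  exact: ltW (harmonic_gt0 _).
have I0 k : Iex square_odp 0 (const_mx (harmonic k)) = finset.set0.
  apply/setP => i; rewrite !inE; apply/negbTE/existsPn => j.
  rewrite dk mxE /= eqe oppr_eq0 gt_eqF ?harmonic_gt0//.
  by rewrite andbF.
exists finset.set0, (fun=> 0), (fun=> 0), (fun k => const_mx (harmonic k)).
exists (fun=> 0).
split; [exact: finset.sub0set | by left | | by []].
split=> [|k|k|k m].
- by split; [exact: cvg_cst|exact: cvg_const_harmonic|exact: cvg_cst].
- by rewrite grad_cst /derT mul0mx addr0.
- apply: limiting_normal_cone0; apply/square_GammaE.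
  by rewrite dk mxE oppr_le0 ltW ?harmonic_gt0.
- by rewrite !J0 !I0.
Qed.

(** The derivative at [steep_point k] tends to 0, and [steep_multiplier k] is
    its inverse: the unbounded multipliers keep the image at 1. *)
Definition steep_point k : 'rV[R]_1 := const_mx (harmonic k).
Definition steep_multiplier k : 'rV[R]_1 := const_mx ((2 * harmonic k)^-1).

Lemma steep_multiplier_normal k :
  regular_normal_cone (Gamma square_odp) 0 (steep_multiplier k).
Proof.
by apply: square_regular_normal_cone; rewrite invr_ge0 mulr_ge0 ?harmonic_ge0.
Qed.

Lemma derT_steep k :
  derT square_odp (steep_point k) (steep_multiplier k) = const_mx 1.
Proof.
rewrite square_derT !mxE mulVf// mulf_neq0//.
by rewrite gt_eqF ?harmonic_gt0.
Qed.

Lemma derT0_neq1 (A : set 'rV[R]_1) : ~ (derT square_odp 0 @` A) (const_mx 1).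
Proof.
move=> [lam _]; rewrite square_derT mxE !mulr0 => /rowP/(_ 0).
by rewrite !mxE => /esym/eqP; rewrite oner_eq0.
Qed.

Lemma square_not_AM_regular : ~ AM_regular square_odp 0.
Proof.
move=> /(_ (const_mx 1)) H; apply: derT0_neq1; apply: H.
(* The shift by sqmap (steep_point k) moves the constraint value back to the
   vertex 0, the only point with nonzero normal vectors. *)
exists (fun k => (steep_point k, sqmap (steep_point k))), (fun=> const_mx 1); split.
- apply: (@cvg_pair _ _ _ _ (nbhs (0 : 'rV[R]_1)) (nbhs (0 : 'rV[R]_1))).
    exact: cvg_const_harmonic.
  have sq0 : sqmap z @[z --> (0 : 'rV[R]_1)] --> sqmap 0.
    exact: differentiable_continuous (differentiable_sqmap 0).
  rewrite sqmap0 in sq0.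
  exact: cvg_comp cvg_const_harmonic sq0.
- exact: cvg_cst.
- move=> k; exists (steep_multiplier k); last exact: derT_steep.
  by rewrite /= subrr; exact/regular_normal_cone_limiting/steep_multiplier_normal.
Qed.

Lemma square_not_AS_regular : ~ AS_regular square_odp 0.
Proof.
move=> /(_ (const_mx 1)) H; apply: derT0_neq1; apply: H.
exists steep_point, (fun=> const_mx 1); split.
- exact: cvg_const_harmonic.
- exact: cvg_cst.
- move=> k; exists (steep_multiplier k); last exact: derT_steep.
  by rewrite /= sqmap0; exact: steep_multiplier_normal.
Qed.

(** * The constraint 0 = 0 *)

Definition null_odp : odp R 1 1 1 :=
  @Odp R 1 1 1 (cst 0) (cst 0) (fun _ _ => 0%E) (fun _ _ => 0%E)
    (fun x => differentiable_cst 0 x) (@continuous_grad_cst 1 0)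
    (fun x => differentiable_cst 0 x) (@continuous_jacobian_cst 1 1 0)
    (fun _ _ => lexx 0%E).

Lemma null_in_box j (y : 'rV[R]_1) : in_box null_odp j y = (y == 0).
Proof.
apply/forallP/eqP => [/(_ 0)/=|-> i]; last by rewrite mxE /= lexx.
rewrite !lee_fin => /le_anti y0; apply/rowP => j'.
by rewrite (ord1 j') -y0 mxE.
Qed.

Lemma null_GammaE (y : 'rV[R]_1) : Gamma null_odp y <-> y = 0.
Proof.
split=> [[j _] /=|->]; first by rewrite null_in_box => /eqP.
by exists 0 => //=; rewrite null_in_box.
Qed.

Lemma null_derT x (lam : 'rV[R]_1) : derT null_odp x lam = 0.
Proof. by rewrite /derT /= jacobian_cst trmx0 mulmx0. Qed.

(** Since F' = 0, each image of a cone lies in {0}, which is closed. *)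
Lemma null_outer_limit (X : topologicalType) (g : X -> 'rV[R]_1)
    (N : X -> set 'rV[R]_1) (zbar : X) :
  outer_limit (fun z => derT null_odp (g z) @` N z) zbar `<=` [set 0].
Proof.
move=> y [z [ys [_ ysy Uk]]] /=.
have ys0 : ys = fun=> 0.
  by apply/funext => k; have [lam _ <-] := Uk k; exact: null_derT.
rewrite ys0 in ysy.
exact: (cvg_unique (@norm_hausdorff R 'rV[R]_1) ysy (cvg_cst (0 : 'rV[R]_1))).
Qed.

Lemma null_feasible : Gamma null_odp (con null_odp 0).
Proof. exact/null_GammaE. Qed.

Lemma null_AM_regular : AM_regular null_odp 0.
Proof.
move=> y /null_outer_limit ->.
exists 0; last exact: null_derT.
exact/limiting_normal_cone0/null_feasible.
Qed.

Lemma null_AS_regular : AS_regular null_odp 0.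
Proof.
move=> y /null_outer_limit ->.
exists 0; last exact: null_derT.
exact/regular_normal_cone0/null_feasible.
Qed.

Lemma null_AM_stationary : AM_stationary null_odp 0.
Proof.
split; first exact: null_feasible.
exists (fun=> 0), (fun=> 0), (fun=> 0), (fun=> 0); split=> //.
- by split; exact: cvg_cst.
- by move=> k; rewrite grad_cst null_derT addr0.
- by move=> k; apply: limiting_normal_cone0; rewrite subr0; exact: null_feasible.
Qed.

(** The box is a single point, so that the bound is attained at every shifted
    point and I cannot be empty. *)
Lemma null_not_subMFC : ~ odp_subMFC null_odp 0.
Proof.
move=> [I [xs [lams [deltas [epss [_ Ind [_ _ Nk _] IE]]]]]].
have I0 : 0 \in I.
  have /null_GammaE d0 := (Nk 0%N).1.
  rewrite (IE 0%N) inE; apply/existsP; exists 0.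
  by rewrite inE null_in_box d0 mxE !eqxx.
case: Ind => [Ie|/(_ 0%N (const_mx 1))]; first by rewrite Ie inE in I0.
have -> : \sum_(i in I) (Num.sg (lams 0%N 0 i) * (const_mx 1 : 'rV[R]_1) 0 i) *:
    grad (fun x => con null_odp x 0 i) 0 = 0.
  apply: big1 => i _.
  by rewrite (_ : (fun _ => _) = cst 0) ?grad_cst ?scaler0//;
     apply/funext => x; rewrite mxE.
rewrite eqxx => Ind; suff: false by []; apply: Ind.
- by apply/eqP => /rowP/(_ 0)/eqP; rewrite !mxE oner_eq0.
- by move=> i; rewrite mxE.
- by move=> i; rewrite (ord1 i) I0.
Qed.

End Problems.

Theorem proposition4p10 (R : realType) :
  [/\ ~ (forall (n l t : nat) (P : odp R n.+1 l.+1 t.+1) (xbar : 'rV[R]_n.+1),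
           AM_stationary P xbar -> odp_subMFC P xbar -> AM_regular P xbar),
      ~ (forall (n l t : nat) (P : odp R n.+1 l.+1 t.+1) (xbar : 'rV[R]_n.+1),
           AM_stationary P xbar -> AM_regular P xbar -> odp_subMFC P xbar),
      ~ (forall (n l t : nat) (P : odp R n.+1 l.+1 t.+1) (xbar : 'rV[R]_n.+1),
           AM_stationary P xbar -> odp_subMFC P xbar -> AS_regular P xbar) &
      ~ (forall (n l t : nat) (P : odp R n.+1 l.+1 t.+1) (xbar : 'rV[R]_n.+1),
           AM_stationary P xbar -> AS_regular P xbar -> odp_subMFC P xbar)].
Proof.
have sqS : AM_stationary (@square_odp R) 0.
  apply: subMFC_AM_stationary square_subMFC.
  by apply/square_GammaE; rewrite /= sqmap0 mxE.
split=> H.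
- exact: square_not_AM_regular (H 0%N 0%N 0%N _ _ sqS square_subMFC).
- exact: null_not_subMFC (H 0%N 0%N 0%N _ _ null_AM_stationary null_AM_regular).
- exact: square_not_AS_regular (H 0%N 0%N 0%N _ _ sqS square_subMFC).
- exact: null_not_subMFC (H 0%N 0%N 0%N _ _ null_AM_stationary null_AS_regular).
Qed.
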